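(* Let $(X,\|\cdot\|)$ be a (real) Banach space and let $\partial$ be a feasible subdifferential on $X$. Let $A\subset X$ be a non-empty, convex, bounded and closed set and let $a\in X$. Let $f:X\to\mathbb{R}\cup\{+\infty\}$ be a lower semicontinuous function such that $a\in\mathrm{dom}\, f$, and let $r\in\mathbb{R}$ be such that $$r<\sup_{\delta>0}\inf f(A_\delta).$$ Let $\varepsilon>0$ be arbitrary. Then there exist $\xi\in[a,A]_\varepsilon$ such that $$f(\xi)<\max\{f(a),r\}+\varepsilon,$$ and $p\in\partial f(\xi)$ such that $$\inf p(A)-p(a)>r-f(a).$$
   Context: $\mathrm{dom}\, f=\{x: f(x)<+\infty\}$; $B_X$ is the closed unit ball of $X$; $B^\circ(x;\varepsilon)$ is the open ball of radius $\varepsilon$ around $x$. For non-empty $A\subset X$: $A_\varepsilon:=A+\varepsilon B_X$, $\inf f(A):=\inf_{x\in A}f(x)$, and $\inf p(A):=\inf_{x\in A}p(x)$ for $p\in X^*$. The multidirectional interval is $[a,A]:=\{a+t(x-a): t\in[0,1],\ x\in A\}$, and $[a,A]_\varepsilon:=[a,A]+\varepsilon B_X$. Feasible subdifferential. A subdifferential operator $\partial$ on $X$ assigns to each lower semicontinuous function $f:X\to\mathbb{R}\cup\{+\infty\}$ a multivalued map $\partial f:X\to 2^{X^*}$. It is called feasible on $X$ if it satisfies, for lower semicontinuous functions $f$ and $g$: (P1) $\partial f(x)=\varnothing$ for $x\notin\mathrm{dom}\, f$; (P2) $\partial f(x)=\partial g(x)$ whenever $f\equiv g$ on a neighbourhood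 of $x$; (P3) if $f$ is convex and continuous on a neighbourhood of $x$, then $\partial f(x)$ coincides with the subdifferential in the sense of convex analysis, i.e. the set of $p\in X^*$ with $f(y)\ge f(x)+p(y-x)$ for all $y$ sufficiently close to $x$ (for all $y\in X$ if $f$ is convex on $X$); (P4) if $f$ attains a local minimum at $x\in\mathrm{dom}\, f$, then $0\in\partial f(x)$; (P5) if $g:X\to\mathbb{R}$ is convex and continuous and $f+g$ attains its minimum at $\bar x\in\mathrm{dom}\, f$, then for any $\varepsilon>0$ there exist $x,y\in X$, $p\in\partial f(x)$ and $q\in\partial g(y)$ such that $x,y\in B^\circ(\bar x;\varepsilon)$, $|f(x)-f(\bar x)|<\varepsilon$ and $\|p+q\|<\varepsilon$; (P6) there is a subdifferential operator $\tilde\partial$ on the Banach space $X\times\mathbb{R}$ (whose dual is identified with $X^*\times\mathbb{R}$) satisfying (P1)--(P5) on $X\times\mathbb{R}$ and such that, whenever $g:X\times\mathbb{R}\to\mathbb{R}\cup\{+\infty\}$ is of the form $g(x,t)=f(x)+\kappa t$ with $f:X\to\mathbb{R}\cup\{+\infty\}$ lower semicontinuous and $\kappa\in\mathbb{R}$, one has $\tilde\partial g(x,t)\subseteq\partial f(x)\times\{\kappa\}$ for all $x\in X$, $t\in\mathbb{R}$. *)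

(* Defs.v *)
From HB Require Import structures.
From mathcomp Require Import all_boot all_order all_algebra.
From mathcomp Require Import all_classical all_reals all_analysis.

Set Implicit Arguments.
Unset Strict Implicit.
Unset Printing Implicit Defensive.

Import Order.TTheory GRing.Theory Num.Theory.
Import numFieldNormedType.Exports.

Local Open Scope classical_set_scope.
Local Open Scope ring_scope.

Section Dual.
Context {R : realType}.

Record dual (V : normedModType R) := Dual {
  dual_fun :> {linear V -> R} ;
  dual_continuous : continuous dual_fun }.

Definition dual0 (V : normedModType R) : dual V :=
  @Dual V (\0 : {linear V -> R}) (@cst_continuous V R 0).

(* Extended-real valued so that it is meaningful without a boundedness proof;
   it is finite on continuous linear functionals. *)
Definition dual_norm (V : normedModType R) (p : V -> R) : \bar R :=
  ereal_sup [set `|p v|%:E | v in closed_ball (0 : V) 1].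

End Dual.

Section Sets.
Context {R : realType} {V : normedModType R}.
Implicit Types (A : set V) (a : V).

Definition enlarge A (e : R) : set V :=
  [set x + e *: b | x in A & b in closed_ball (0 : V) 1].

Definition mdinterval a A : set V :=
  [set a + t *: (x - a) | t in `[0, 1]%classic & x in A].

End Sets.

Section Subdifferential.
Context {R : realType}.
Local Open Scope ereal_scope.

(* Lower semicontinuous functions with values in R U {+oo}. *)
Definition lsc (V : normedModType R) (f : V -> \bar R) : Prop :=
  (forall x, f x != -oo) /\ lower_semicontinuous f.

Definition dom (V : normedModType R) (f : V -> \bar R) : set V :=
  [set x | f x < +oo].

(* Counterpart of convex_function for functions that may take the value +oo;
   the convention 0 * +oo = 0 makes the cases t = 0 and t = 1 trivial. *)
Definition econvex (V : normedModType R) (D : set V) (f : V -> \bar R) : Prop :=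
  forall (x y : V) (t : R), D x -> D y -> (0 <= t <= 1)%R ->
    f (t *: x + (1 - t) *: y)%R <= t%:E * f x + (1 - t)%:E * f y.

(* Operators are total on V -> \bar R, but only their values on functions
   satisfying lsc are ever constrained or used. *)
Definition subdiff (V : normedModType R) : Type :=
  (V -> \bar R) -> V -> set (dual V).

(* In subdiff_convex, the finiteness of f near x excludes f x = +oo, where
   subdiff_dom requires the subdifferential to be empty. *)
Record subdiff_axioms (V : normedModType R) (d : subdiff V) : Prop := {
  subdiff_dom : forall f x, lsc f -> ~ dom f x -> d f x = set0 ;
  subdiff_local : forall f g x, lsc f -> lsc g ->
    (\forall y \near x, f y = g y) -> d f x = d g x ;
  subdiff_convex : forall f x, lsc f ->
    (exists2 e : R, (0 < e)%R &
      [/\ forall y, ball x e y -> f y \is a fin_num,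
          econvex (ball x e) f &
          forall y, ball x e y -> {for y, continuous f}]) ->
    d f x = [set p | \forall y \near x, f x + (p (y - x)%R)%:E <= f y] /\
    (econvex setT f ->
      d f x = [set p | forall y, f x + (p (y - x)%R)%:E <= f y]) ;
  subdiff_min : forall f x, lsc f -> dom f x ->
    (\forall y \near x, f x <= f y) -> d f x (dual0 V) ;
  subdiff_sum : forall f (g : V -> R) x0, lsc f ->
    convex_function setT g -> continuous g -> dom f x0 ->
    (forall z, f x0 + (g x0)%:E <= f z + (g z)%:E) ->
    forall e : R, (0 < e)%R ->
    exists x y (p q : dual V),
      [/\ d f x p, d (EFin \o g) y q, ball x0 e x /\ ball x0 e y,
          `|f x - f x0| < e%:E & dual_norm (p \+ q)%R < e%:E] }.

(* An element of the dual of X * R is identified with a pair (p, k) through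
   (y, s) |-> p y + k * s. The library's norm on X * R is the max norm; the
   axioms do not depend on the choice among equivalent norms. *)
Definition feasible (X : completeNormedModType R) (d : subdiff X) : Prop :=
  subdiff_axioms d /\
  exists2 d' : subdiff (X * R)%type, subdiff_axioms d' &
    forall (f : X -> \bar R) (k : R) (x : X) (t : R), lsc f ->
      d' (fun z => f z.1 + (k * z.2)%:E) (x, t) `<=`
      [set P | exists2 p : dual X, d f x p &
                 forall y s, P (y, s) = (p y + k * s)%R].

End Subdifferential.

(* Main.v *)
(** Fix [r < r2 < inf f (A_delta)]. In the coordinates [(tau x, tau)] moving
    from [x] towards a point [z] of [A] is a translation by a multiple of
    [(z, 1)], so a Bishop-Phelps argument on a closed convex cone in [X * R]
    yields a point [b] reached from [a] with [b - c] on the segment from [a]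
    to some [z0] in [A] for a small vector [c], such that [f] lies strictly above
    the affine interpolation between its bound at [b] and [r2] on a thin drop
    from [b] around the translate [A + c]. The parameter [tau] alone controls
    the displacement, so [f] may be unbounded below.

    Near [b] the function [f] is bounded below. There one minimizes [f + g],
    where [g] penalizes with a large constant the distance to the drop and
    rewards progress towards [A + c] at a rate [k] slightly smaller than
    the slope of that interpolation. The sum rule (P5) then gives [p] with
    [p (z + c - b) >= k] up to a small error for all [z] in [A]; the
    contributions of [c] cancel and the inequality rescales to one for [a]. *)

Require Import Defs.
From HB Require Import structures.
From mathcomp Require Import all_boot all_order all_algebra.
From mathcomp Require Import all_classical all_reals all_analysis.
From mathcomp Require Import ring lra.

Import Order.TTheory GRing.Theory Num.Theory.
Import numFieldNormedType.Exports.

Local Open Scope classical_set_scope.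
Local Open Scope ring_scope.

(** * Maximal points for the order of a closed convex cone in [X * R] *)

(** Greedy iteration: each step rises at least half-way to the supremum of the second coordinate
    over the points of [E] above the current one. The second coordinates increase and are bounded,
    hence converge; the bound by [C] then makes the first coordinates Cauchy, and nothing in [E]
    lies above the limit but itself. *)
Lemma bishop_phelps (R : realType) (X : completeNormedModType R)
    (E K : set (X * R)) (C M : R) (x0 : X * R) :
    closed E -> closed K -> K 0 -> (forall v w, K v -> K w -> K (v + w)) ->
    0 < C -> (forall v, K v -> `|v.1| <= C * v.2) ->
    E x0 -> (forall x, E x -> K (x - x0) -> x.2 <= M) ->
  exists x, [/\ E x, K (x - x0) & forall y, E y -> K (y - x) -> y = x].
Proof.
move=> Ecl Kcl K0 KD C0 KC Ex0 EM.
have K2 v : K v -> 0 <= v.2.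
  by move=> /KC h; rewrite -(pmulr_rge0 _ C0); exact: le_trans h.
have KT x y z : K (z - y) -> K (y - x) -> K (z - x).
  by move=> zy yx; rewrite -[z](subrK y) -addrA; exact: KD.
have [st stP] : {st : X * R -> X * R & forall x, E x -> K (x - x0) ->
    [/\ E (st x), K (st x - x) &
      forall z, E z -> K (z - x) -> z.2 <= 2 * (st x).2 - x.2]}.
  suff h x : exists y, E x -> K (x - x0) -> [/\ E y, K (y - x) &
      forall z, E z -> K (z - x) -> z.2 <= 2 * y.2 - x.2].
    by have [st ?] := choice h; exists st.
  have [[Ex Kx]|nx] := pselect (E x /\ K (x - x0)); last first.
    by exists x => Ex Kx; case: nx.
  set S := [set y.2 | y in [set y | E y /\ K (y - x)]].
  have Sx : S x.2 by exists x => //; split=> //; rewrite subrr.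
  have Sub : has_sup S.
    split; first by exists x.2.
    exists M => _ [y [Ey Kyx] <-]; apply: EM => //.
    exact: KT Kyx Kx.
  have Sle z : E z -> K (z - x) -> z.2 <= sup S.
    by move=> Ez Kz; apply: ub_le_sup; [case: Sub|exists z].
  have [Slx|Sgx] := leP (sup S) x.2.
    exists x => _ _; split=> //; first by rewrite subrr.
    by move=> z Ez Kz; have := Sle z Ez Kz; lra.
  have e0 : 0 < (sup S - x.2) / 2 by rewrite divr_gt0// subr_gt0.
  have [_ [y [Ey Ky] <-] hy] := sup_adherent e0 Sub.
  exists y => _ _; split=> // z Ez Kz.
  by have := Sle z Ez Kz; lra.
pose x n := iter n st x0.
have xP n : E (x n) /\ K (x n - x0).
  elim: n => [|n [IE IK]]; first by split=> //; rewrite /= subrr.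
  by have [? ? _] := stP _ IE IK; split=> //; exact: KT IK.
have xK n m : (n <= m)%N -> K (x m - x n).
  move=> /subnK <-; elim: (m - n)%N => [|k IK]; first by rewrite subrr.
  have [IE' IK'] := xP (k + n)%N.
  by have [_ ? _] := stP _ IE' IK'; exact: KT IK.
pose t n := (x n).2; pose u n := (x n).1.
have tnd : nondecreasing_seq t.
  by move=> n m /xK /K2 /=; rewrite subr_ge0.
have /cvg_ex[/= tl tcv] : cvgn t.
  apply: nondecreasing_is_cvgn => //; exists M => _ [n _ <-].
  by have [? ?] := xP n; exact: EM.
have tle n : t n <= tl.
  rewrite -(cvg_lim _ tcv)//; apply: nondecreasing_cvgn_le => //.
  by apply/cvg_ex; exists tl.
have /cvg_ex[/= ul ucv] : cvgn u.
  apply/cauchy_cvgP/cauchy_exP => e e0.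
  have eC : 0 < e / C by rewrite divr_gt0.
  have /cvgrPdist_lt/(_ _ eC)[N _ hN] := tcv.
  exists (u N); exists N => // n /= Nn.
  rewrite -ball_normE /ball_/= distrC.
  apply: le_lt_trans (KC _ (xK _ _ Nn)) _.
  rewrite mulrC -ltr_pdivlMr//=.
  have := hN N (leqnn _); rewrite /= ger0_norm ?subr_ge0 ?tle//.
  by apply: le_lt_trans; rewrite lerB// -/(t n).
have xcv : x @ \oo --> (ul, tl).
  have -> : x = fun n => (u n, t n).
    by apply/funext => n; rewrite /u /t; case: (x n).
  have h : (u n, t n) @[n --> \oo] --> (nbhs ul, nbhs tl).
    exact: (cvg_pair ucv tcv).
  exact: h.
have El : E (ul, tl).
  have h : \forall n \near \oo, E (x n) by near=> n; have [] := xP n.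
  exact: (@closed_cvg _ _ \oo _ x E Ecl h _ xcv).
have Kl n : K ((ul, tl) - x n).
  have h : (x m - x n) @[m --> \oo] --> (ul, tl) - x n.
    by apply: cvgB => //; exact: cvg_cst.
  have k : \forall m \near \oo, K (x m - x n) by exists n => // m; exact: xK.
  exact: (@closed_cvg _ _ \oo _ _ K Kcl k _ h).
exists (ul, tl); split=> //; first exact: (Kl 0%N).
move=> y Ey Ky.
(* A point above the limit is above every iterate, so the half-way property bounds its second
   coordinate; letting [n] grow leaves no room for a rise, and [C] then leaves none for a
   displacement. *)
have yle n : y.2 <= 2 * t n.+1 - t n.
  by have [IE IK] := xP n; have [_ _] := stP _ IE IK; apply=> //; exact: KT (Kl n).
have y2 : y.2 <= tl.
  suff : y.2 <= 2 * tl - tl by rewrite mulr_natl mulr2n addrK.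
  apply: (@closed_cvg _ _ \oo _ (fun n => 2 * t n.+1 - t n) (fun z => y.2 <= z)).
  - exact: closed_ge.
  - by near=> n; exact: yle.
  - apply: cvgB => //; apply: cvgMr.
    have -> : (fun n => t n.+1) = [sequence t (n + 1)%N]_n.
      by apply/funext => n; rewrite /= addn1.
    by rewrite cvg_shiftn.
have y2e : y.2 = tl by apply/le_anti; rewrite y2/=; move/K2: Ky => /=; rewrite subr_ge0.
have := KC _ Ky; rewrite /= y2e subrr mulr0 normr_le0 subr_eq0 => /eqP.
by move: y2e; case: (y) => /= ? ? -> ->.
Unshelve. all: by end_near. Qed.

(** * Semicontinuity and convexity tools *)

Lemma lsc_sublevel_closed (R : realType) (X Y : topologicalType)
    (f : X -> \bar R) (k : Y -> X) (h : Y -> R) :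
    lower_semicontinuous f -> continuous k -> continuous h ->
  closed [set y | (f (k y) <= (h y)%:E)%E].
Proof.
move=> fl kc hc; rewrite closedE /= => p np.
rewrite leNgt; apply/negP => hf; apply: np.
have [al hal alf] : exists2 al, h p < al & (al%:E < f (k p))%E.
  move: hf; case: (f (k p)) => [v| |] //.
    by rewrite lte_fin => /midf_lt[? ?]; exists ((h p + v) / 2).
  by exists (h p + 1); rewrite ?ltrDl// ltry.
have [V Vn Vf] := fl _ _ alf.
have h1 : \forall y \near p, V (k y) by exact: kc.
have h2 : \forall y \near p, h y < al.
  by apply: (hc p (fun z => z < al)); exact: lt_nbhsl.
near=> y; apply/negP; rewrite -ltNge.
apply: (@lt_trans _ _ al%:E); first by rewrite lte_fin; near: y.
by apply: Vf; near: y.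
Unshelve. all: by end_near. Qed.

Lemma convex_setP (R : realType) (X : normedModType R) (A : set X) (x y : X)
    (t : R) :
  convex_set A -> A x -> A y -> 0 <= t <= 1 -> A (t *: x + (1 - t) *: y).
Proof.
move=> cA Ax Ay /andP[t0 t1].
by have := cA x y (Itv01 t0 t1) (mem_set Ax) (mem_set Ay); rewrite inE.
Qed.

(** Normalizing the weights by [s + t] gives a convex combination; if the sum vanishes, so do both
    weights and any point serves. *)
Lemma convex_set_cone (R : realType) (X : normedModType R) (A : set X) (x y : X)
    (s t : R) :
    convex_set A -> A x -> A y -> 0 <= s -> 0 <= t ->
  exists2 z, A z & s *: x + t *: y = (s + t) *: z.
Proof.
move=> cA Ax Ay s0 t0; have [st0|st0] := eqVneq (s + t) 0.
  have -> : s = 0 by lra.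
  have -> : t = 0 by lra.
  by exists x => //; rewrite addr0 !scale0r addr0.
have stp : 0 < s + t by rewrite lt_neqAle eq_sym st0 addr_ge0.
exists (s / (s + t) *: x + (1 - s / (s + t)) *: y).
  by apply: convex_setP => //; rewrite divr_ge0 ?addr_ge0//= ler_pdivrMr// mul1r lerDl.
by rewrite scalerDr !scalerA; congr (_ *: _ + _ *: _); field.
Qed.

Lemma bounded_set_norm (R : realType) (X : normedModType R) (A : set X) :
  bounded_set A -> exists2 M, 0 < M & forall x, A x -> `|x| <= M.
Proof.
move=> /ex_strict_bound_gt0[M M0 AM]; exists M => // x Ax.
by apply/ltW; exact: AM.
Qed.

(** * The cone over an inflation of [A] and the drop it produces *)

(* The closure of [{(mu y, mu) | mu >= 0, dist(y, A) <= rho}]. *)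
Definition inflated_cone {R : realType} {X : normedModType R} (A : set X)
    (rho : R) : set (X * R) :=
  [set v | 0 <= v.2 /\ forall e, 0 < e ->
     exists2 z, A z & `|v.1 - v.2 *: z| <= rho * v.2 + e].

Section inflated_cone.
Context (R : realType) (X : normedModType R) (A : set X) (rho M : R).
Hypotheses (A0 : A !=set0) (cA : convex_set A) (rho0 : 0 < rho) (M0 : 0 < M).
Hypothesis AM : forall x, A x -> `|x| <= M.
Let K := inflated_cone A rho.

Lemma inflated_cone0 : K 0.
Proof.
split => //= e e0; have [z Az] := A0; exists z => //.
by rewrite scale0r subr0 normr0 mulr0 add0r ltW.
Qed.

Lemma inflated_cone_bound v : K v -> `|v.1| <= (M + rho) * v.2.
Proof.
move=> [v0 Kv]; apply/ler_addgt0Pr => e e0.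
have [z Az hz] := Kv e e0.
rewrite -[v.1](subrK (v.2 *: z)); apply: le_trans (ler_normD _ _) _.
rewrite normrZ (ger0_norm v0).
have := ler_wpM2l v0 (AM _ Az); lra.
Qed.

Lemma inflated_coneD v w : K v -> K w -> K (v + w).
Proof.
move=> [v0 Kv] [w0 Kw]; split=> /=; first exact: addr_ge0.
move=> e e0; have e2 : 0 < e / 2 by rewrite divr_gt0.
have [z1 Az1 h1] := Kv _ e2; have [z2 Az2 h2] := Kw _ e2.
have [z Az zE] := convex_set_cone _ _ _ _ _ _ _ cA Az1 Az2 v0 w0.
exists z => //; have -> : (v + w).1 - (v.2 + w.2) *: z =
    (v.1 - v.2 *: z1) + (w.1 - w.2 *: z2) by rewrite -zE opprD addrACA.
by apply: le_trans (ler_normD _ _) _; rewrite mulrDr; lra.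
Qed.

Lemma inflated_cone_closed : closed K.
Proof.
rewrite closedE => p np.
have near_p d : 0 < d -> exists v, K v /\ `|p.1 - v.1| < d /\ `|p.2 - v.2| < d.
  move=> d0; apply: contrapT => nv; apply: np.
  apply/nbhs_ballP; exists d => //= v [/= bv1 bv2] Kv; apply: nv.
  exists v; split=> //.
  by move: bv1 bv2; rewrite -!ball_normE.
split.
  rewrite leNgt; apply/negP => p0.
  have [|v [[v0 _] [_]]] := near_p (- p.2); first by rewrite oppr_gt0.
  by rewrite ltr_norml => /andP[h _]; move: v0 h; rewrite opprK /=; lra.
move=> e e0.
(* The divisor counts the errors: [d] from the first coordinate, [d] from the slack at [v], [d * M]
   from rescaling [z] and [rho * d] from the change of radius. *)
pose d := e / (2 + M + rho).
have D0 : 0 < 2 + M + rho by rewrite !addr_gt0.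
have d0 : 0 < d by rewrite divr_gt0.
have [v [[v0 Kv] [h1 h2]]] := near_p _ d0.
have [z Az hz] := Kv _ d0; exists z => //.
have -> : p.1 - p.2 *: z = (p.1 - v.1) + (v.1 - v.2 *: z) + (v.2 - p.2) *: z.
  by rewrite addrA subrK scalerBl addrA subrK.
apply: le_trans (ler_normD _ _) _.
apply: le_trans (lerD (ler_normD _ _) (lexx _)) _; rewrite normrZ.
have h3 : `|v.2 - p.2| * `|z| <= d * M.
  by apply: ler_pM => //; [rewrite distrC ltW|exact: AM].
have h4 : rho * v.2 <= rho * p.2 + rho * d.
  rewrite -mulrDr; apply: ler_wpM2l; first exact: ltW.
  by move: h2; rewrite ltr_norml => /andP[]; lra.
have : d * (2 + M + rho) = e by rewrite /d divfK// gt_eqF.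
lra.
Qed.

End inflated_cone.

(* The maximal element is taken in the homogeneous coordinates [(tau x, tau)],
   in which moving from [x] towards [A] is a translation by an element of the
   cone over the inflation of [A], and [tau (r2 - f x) >= lam] is the condition
   preserved along the way. *)
Lemma drop_maximal (R : realType) (X : completeNormedModType R) (A : set X)
    (f : X -> \bar R) (a : X) (fa rho r2 r3 : R) :
    A !=set0 -> convex_set A -> bounded_set A -> lower_semicontinuous f ->
    f a = fa%:E -> 0 < rho -> r2 < r3 ->
    (forall x z, A z -> `|x - z| <= 2 * rho -> (r3%:E <= f x)%E) ->
  exists T b z0 c,
    [/\ 0 < T <= 1, A z0, b = T *: a + (1 - T) *: z0 + c,
        `|c| + rho * T / 2 <= rho & (f b <= (r2 - T * (r2 - fa))%:E)%E /\
        forall z s e, A z -> 0 < s < 1 -> `|e| <= rho * T / 2 * s ->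
          ((r2 - (1 - s) * (T * (r2 - fa)))%:E <
             f (b + s *: (z + c - b) + e)%R)%E].
Proof.
move=> A0 cA bA fl fafa rho0 r23 fr3.
have [M M0 AM] := bounded_set_norm _ _ _ bA.
pose lam := r2 - fa.
(* The truncation at 1 makes the inverse of [tau] continuous on the whole product without changing
   it on [E]. *)
pose m (y : X * R) : R := (Num.max 1 y.2)^-1.
have mE y : 1 <= y.2 -> m y = y.2^-1.
  by move=> h; congr (_^-1); exact/max_idPr.
pose E := [set y : X * R | 1 <= y.2] `&`
  [set y : X * R | (f (m y *: y.1)%R <= (r2 - lam * m y)%:E)%E].
have EP y : E y <-> 1 <= y.2 /\ (f (y.2^-1 *: y.1)%R <= (r2 - lam * y.2^-1)%:E)%E.
  by rewrite /E /=; split=> -[h1]; rewrite mE.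
pose K := inflated_cone A rho.
have mcont : continuous m.
  move=> y; apply: cvgV; first by rewrite gt_eqF// lt_max ltr01.
  apply: (@continuous_max _ _ (fun=> 1) (fun y : X * R => y.2)).
    exact: cvg_cst.
  exact: cvg_snd.
have Ecl : closed E.
  apply: closedI.
    apply: (@closed_comp _ _ (fun y : X * R => y.2) [set t : R | 1 <= t]).
      by move=> y _; exact: cvg_snd.
    exact: closed_ge.
  apply: lsc_sublevel_closed => // y.
    by apply: cvgZ; [exact: mcont|exact: cvg_fst].
  by apply: cvgB; [exact: cvg_cst|apply: cvgM; [exact: cvg_cst|exact: mcont]].
have Ea : E (a, 1).
  by apply/EP; split=> //=; rewrite invr1 scale1r mulr1 fafa lee_fin /lam subKr.
(* Beyond this height, the first summand puts the represented point within [2 * rho] of [A], where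
   [f] is at least [r3], and the second makes that incompatible with membership in [E]. *)
have Ebd x : E x -> K (x - (a, 1)) ->
    x.2 <= (`|a| + M) / rho + `|lam| / (r3 - r2) + 1.
  move=> /EP[x1 fx] [_ Kx]; have [z Az /= hz] := Kx _ rho0.
  have x0 : 0 < x.2 by rewrite (lt_le_trans _ x1).
  rewrite leNgt; apply/negP => hx.
  have p1 : 0 <= (`|a| + M) / rho by rewrite divr_ge0 ?addr_ge0// ltW.
  have p2 : 0 <= `|lam| / (r3 - r2) by rewrite divr_ge0// subr_ge0 ltW.
  have q1 : `|a| + M <= rho * x.2 by rewrite mulrC -ler_pdivrMr//; lra.
  have q2 : `|lam| < (r3 - r2) * x.2.
    by rewrite mulrC -ltr_pdivrMr ?subr_gt0//; lra.
  have xz : `|x.2^-1 *: x.1 - z| <= 2 * rho.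
    have -> : x.2^-1 *: x.1 - z = x.2^-1 *: (x.1 - x.2 *: z).
      by rewrite scalerBr scalerA mulVf ?scale1r// gt_eqF.
    rewrite normrZ gtr0_norm ?invr_gt0// [_^-1 * _]mulrC ler_pdivrMr//.
    have -> : x.1 - x.2 *: z = (x.1 - a - (x.2 - 1) *: z) + (a - z).
      by rewrite scalerBl scale1r opprB addrAC !addrA !subrK.
    apply: le_trans (ler_normD _ _) _.
    apply: le_trans (lerD hz (ler_normB _ _)) _.
    by have := AM _ Az; lra.
  have := le_trans (fr3 _ _ Az xz) fx; rewrite lee_fin => h.
  have : (r3 - r2) * x.2 <= - lam.
    have -> : - lam = (- (lam * x.2^-1)) * x.2 by rewrite mulNr divfK// gt_eqF.
    by rewrite ler_pM2r//; lra.
  by have := ler_norm (- lam); rewrite normrN; lra.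
have MR0 : 0 < M + rho by rewrite addr_gt0.
have [[u t] [/EP[/= t1 fu] Ku umax]] := bishop_phelps _ _ _ _ _ _ (a, 1) Ecl
  (inflated_cone_closed _ _ _ _ _ rho0 M0 AM) (inflated_cone0 _ _ _ _ A0)
  (inflated_coneD _ _ _ _ cA) MR0 (inflated_cone_bound _ _ _ _ _ AM) Ea Ebd.
have t0 : 0 < t by rewrite (lt_le_trans _ t1).
have tn0 : t != 0 by rewrite gt_eqF.
have rho2 : 0 < rho / 2 by rewrite divr_gt0.
(* Slack [rho / 2] gives an error of at most [rho * (t - 1) + rho / 2]; after division by [t] this
   leaves [rho * T / 2] for the width of the drop. *)
have [_ /(_ _ rho2)[z0 Az0 /= hc]] := Ku.
pose c1 := u - a - (t - 1) *: z0.
have uE : u = a + (t - 1) *: z0 + c1 by apply/eqP; rewrite addrC -subr_eq /c1 opprD addrA.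
have cb : `|t^-1 *: c1| + rho * t^-1 / 2 <= rho.
  rewrite normrZ gtr0_norm ?invr_gt0//.
  have -> : t^-1 * `|c1| + rho * t^-1 / 2 = (`|c1| + rho / 2) / t.
    by rewrite mulrDl mulrAC [t^-1 * _]mulrC.
  by rewrite ler_pdivrMr//; move: hc; rewrite -/c1; lra.
exists t^-1, (t^-1 *: u), z0, (t^-1 *: c1); split=> //.
- by rewrite invr_gt0 t0/= invf_le1.
- by rewrite {1}uE 2!scalerDr scalerA mulrBr mulVf// mulr1.
split; first by rewrite [t^-1 * _]mulrC.
move=> z s e Az /andP[s0 s1] es; rewrite ltNge; apply/negP => fy.
set y := t^-1 *: u + _ + e in fy.
(* With this height [t' - t = t' * s], so a point [y] violating the drop inequality yields
   [(t' *: y, t')] in [E], strictly above the maximal element. *)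
have [t' t'E] : exists t', t' = t / (1 - s) by exists (t / (1 - s)).
have s10 : 0 < 1 - s by rewrite subr_gt0.
have s1n : 1 - s != 0 by rewrite gt_eqF.
have tt' : t' - t = t' * s by rewrite t'E; field.
have t'0 : 0 < t' by rewrite t'E divr_gt0.
have tlt : t < t' by rewrite -subr_gt0 tt' mulr_gt0.
have : (t' *: y, t') = (u, t).
  apply: umax.
    apply/EP; split => /=; first by rewrite (le_trans t1)// ltW.
    rewrite scalerA mulVf ?gt_eqF// scale1r; apply: le_trans fy _.
    by rewrite lee_fin t'E invf_div -/lam; lra.
  split; rewrite /= ?subr_ge0 ?ltW// tt' => e' e'0; exists z => //.
  have -> : t' *: y - u - (t' * s) *: z = t' *: (s *: (t^-1 *: c1) + e).
    have -> : u = (t' * (1 - s)) *: (t^-1 *: u).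
      by rewrite scalerA t'E divfK// mulfV// scale1r.
    rewrite -!scalerA -!scalerBr; congr (t' *: _); rewrite /y.
    rewrite scalerBl scale1r scalerBr scalerDr opprB !addrA.
    rewrite [LHS](ACl (1*7*2*8*4*6*3*5))/=.
    by rewrite subrr add0r subrr add0r addNr add0r.
  rewrite normrZ gtr0_norm//.
  have : `|s *: (t^-1 *: c1) + e| <= rho * s.
    apply: le_trans (ler_normD _ _) _; rewrite normrZ gtr0_norm//.
    have := ler_wpM2l (ltW s0) cb; lra.
  by move=> /(ler_wpM2l (ltW t'0)); lra.
by move=> [_ h]; rewrite h ltxx in tlt.
Qed.

(** * The convex penalty function *)

(* Restricting the step [p.1] to a bounded interval makes the infimum finite
   for every sign of [k]. *)
Definition descent {R : realType} {X : normedModType R} (B : set X) (M k : R)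
    (v : X) : R :=
  inf [set M * `|v - p.1 *: p.2| - p.1 * k | p in `[0, 1/2]%classic `*` B].

Section descent.
Context (R : realType) (X : normedModType R) (B : set X) (M k : R).
Hypotheses (B0 : B !=set0) (cB : convex_set B) (M0 : 0 < M).
Let G := descent B M k.

Let has_inf_G v : has_inf
  [set M * `|v - p.1 *: p.2| - p.1 * k | p in `[0, 1/2]%classic `*` B].
Proof.
have [w Bw] := B0; split.
  exists (M * `|v - 0 *: w| - 0 * k); exists (0, w) => //; split => //=.
  by rewrite in_itv/= lexx divr_ge0.
exists (- `|k|) => _ [[s z] [/= + Bz] <-]; rewrite /= in_itv/= => /andP[s0 s1].
have h : s * k <= s * `|k| by rewrite ler_wpM2l// ler_norm.
have h' : s * `|k| <= 1 * `|k| by rewrite ler_wpM2r//; lra.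
have : 0 <= M * `|v - s *: z| by rewrite mulr_ge0// ltW.
lra.
Qed.

Lemma descent_le v s w : 0 <= s <= 1/2 -> B w ->
  G v <= M * `|v - s *: w| - s * k.
Proof.
move=> s01 Bw; apply: ge_inf; first by case: (has_inf_G v).
by exists (s, w) => //; split => //=; rewrite in_itv.
Qed.

Lemma descent_adherent v e : 0 < e ->
  exists s w, [/\ 0 <= s <= 1/2, B w & M * `|v - s *: w| - s * k < G v + e].
Proof.
move=> e0; have [_ [[s w] [/= + Bw] <-] h] := inf_adherent e0 (has_inf_G v).
by rewrite in_itv/= => s01; exists s, w.
Qed.

Lemma descent_lipschitz v v' : G v <= G v' + M * `|v - v'|.
Proof.
apply/ler_addgt0Pr => e e0; have [s [w [s01 Bw h]]] := descent_adherent v' e e0.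
apply: le_trans (descent_le v s w s01 Bw) _.
have : M * `|v - s *: w| <= M * (`|v - v'| + `|v' - s *: w|).
  by rewrite ler_wpM2l ?(ltW M0)// ler_distD.
lra.
Qed.

Lemma descent_continuous : continuous G.
Proof.
move=> v; apply/cvgrPdist_lt => e e0.
have eM : 0 < e / M by rewrite divr_gt0.
apply/nbhs_ballP; exists (e / M) => //= w; rewrite -ball_normE /= => vw.
have : M * `|v - w| < e by rewrite mulrC -ltr_pdivlMr.
have := descent_lipschitz v w; have := descent_lipschitz w v.
by rewrite [`|w - v|]distrC ltr_norml; lra.
Qed.

(** The pairs of a step [s] and a displacement [s *: w] with [w] in [B] form a convex set, on which
    the cost is jointly convex in [v] and the pair; averaging near-optimal pairs for [x] and [y]
    gives an admissible one. *)
Lemma descent_convex x y t : 0 <= t <= 1 ->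
  G (t *: x + (1 - t) *: y) <= t * G x + (1 - t) * G y.
Proof.
move=> /andP[t0 t1]; apply/ler_addgt0Pr => e e0.
have [s1 [w1 [/andP[s10 s11] Bw1 h1]]] := descent_adherent x e e0.
have [s2 [w2 [/andP[s20 s21] Bw2 h2]]] := descent_adherent y e e0.
have t1' : 0 <= 1 - t by rewrite subr_ge0.
have p1 : 0 <= t * s1 by rewrite mulr_ge0.
have p2 : 0 <= (1 - t) * s2 by rewrite mulr_ge0.
have [w Bw wE] := convex_set_cone _ _ _ _ _ _ _ cB Bw1 Bw2 p1 p2.
have s01 : 0 <= t * s1 + (1 - t) * s2 <= 1/2.
  rewrite addr_ge0//=; have := ler_wpM2l t0 s11; have := ler_wpM2l t1' s21; lra.
apply: le_trans (descent_le _ _ w s01 Bw) _; rewrite -wE.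
have -> : t *: x + (1 - t) *: y - (t * s1 *: w1 + (1 - t) * s2 *: w2) =
    t *: (x - s1 *: w1) + (1 - t) *: (y - s2 *: w2).
  by rewrite !scalerBr !scalerA opprD addrACA.
have h : `|t *: (x - s1 *: w1) + (1 - t) *: (y - s2 *: w2)| <=
    t * `|x - s1 *: w1| + (1 - t) * `|y - s2 *: w2|.
  by apply: le_trans (ler_normD _ _) _; rewrite !normrZ !ger0_norm.
have := ler_wpM2l (ltW M0) h.
have := ler_wpM2l t0 (ltW h1); have := ler_wpM2l t1' (ltW h2).
lra.
Qed.

End descent.

(* The subgradient inequality is tested at a point whose optimal step is a
   convex combination of that of [y] and [w], with the same error vector. *)
Lemma descent_subgradient (R : realType) (X : normedModType R) (B : set X)
    (M k sg zt D s : R) (q : {linear X -> R}) (b x y wy w : X) :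
    B !=set0 -> convex_set B -> 0 < M -> 0 <= sg -> 0 <= zt ->
    (forall v, descent B M k (y - b) + sg * `|y - x| + q (v - y) <=
               descent B M k (v - b) + sg * `|v - x|) ->
    0 <= s -> 4 * s <= 1 -> B wy ->
    M * `|y - b - s *: wy| - s * k <= descent B M k (y - b) + zt ->
    B w -> `|w| <= D ->
  q w <= - k + sg * D + 4 * zt.
Proof.
move=> B0 cB M0 sg0 zt0 hq s1 s4 Bwy hy Bw wD.
(* The length left up to the cap [1/2]. It is at least [1/4], which accounts for the factor 4 before
   [zt] after division by [t]. *)
pose t := 1/2 - s.
have t14 : 1/4 <= t by rewrite /t; lra.
have t0 : 0 < t by rewrite (lt_le_trans _ t14).
have [wc Bwc wcE] := convex_set_cone _ _ _ _ _ _ _ cB Bwy Bw s1 (ltW t0).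
have half : s + t = 1/2 by rewrite /t addrC subrK.
have test : descent B M k (y + t *: w - b) <=
    M * `|y - b - s *: wy| - 1/2 * k.
  have h01 : 0 <= (1/2 : R) <= 1/2 by apply/andP; split; [exact: divr_ge0|].
  apply: le_trans (descent_le _ _ _ _ _ B0 M0 _ _ wc h01 Bwc) _.
  rewrite -half -wcE.
  by rewrite opprD addrA [y + _ - b]addrAC [_ - s *: wy]addrAC addrK.
have := hq (y + t *: w).
have -> : q (y + t *: w - y) = t * q w by rewrite addrC addKr; exact: linearZ.
have : `|y + t *: w - x| <= `|y - x| + t * D.
  rewrite addrAC; apply: le_trans (ler_normD _ _) _; rewrite normrZ gtr0_norm//.
  by rewrite lerD2l ler_wpM2l// ltW.
move=> /(ler_wpM2l sg0) hn hq'.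
have tzt : 1/4 * (4 * zt) <= t * (4 * zt) by rewrite ler_wpM2r// mulr_ge0.
rewrite -(ler_pM2l t0); move: hq' hn test hy; rewrite -half; lra.
Qed.

(** * The Ekeland variational principle *)

(** A maximal point of the hypograph of [- (f + g)] for the cone [sigma * |v.1| <= v.2] is a point
    where [f + g] cannot decrease at a rate above [sigma]. *)
Lemma ekeland (R : realType) (X : completeNormedModType R) (f : X -> \bar R)
    (g : X -> R) (x0 : X) (f0 m sigma : R) :
    lower_semicontinuous f -> continuous g ->
    (forall x, m%:E <= f x + (g x)%:E)%E -> f x0 = f0%:E -> 0 < sigma ->
  exists x fx, [/\ f x = fx%:E, fx + g x <= f0 + g x0 &
    forall y, ((fx + g x)%:E <= f y + (g y + sigma * `|y - x|)%:E)%E].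
Proof.
move=> fl gc fm fx0 sigma0.
have fN x : f x != -oo%E.
  by apply/negP => /eqP fx; have := fm x; rewrite fx.
pose E := [set y : X * R | (f y.1 <= (- y.2 - g y.1)%R%:E)%E].
pose K := [set v : X * R | sigma * `|v.1| <= v.2].
have Ecl : closed E.
  apply: lsc_sublevel_closed => // y; first exact: cvg_fst.
  apply: cvgB; first by apply: cvgN; exact: cvg_snd.
  by apply: (cvg_comp _ _ (@cvg_fst _ _ _ _ _)); exact: gc.
have Kcl : closed K.
  rewrite (_ : K = (fun v : X * R => v.2 - sigma * `|v.1|) @^-1` [set t | 0 <= t]).
    apply: closed_comp; last exact: closed_ge.
    move=> v _; apply: cvgB; first exact: cvg_snd.
    apply: cvgMr; apply: cvg_norm; exact: cvg_fst.
  by apply/funext => v; rewrite /K /= subr_ge0.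
have K0 : K 0 by rewrite /K /= normr0 mulr0.
have KD v w : K v -> K w -> K (v + w).
  rewrite /K /= => Kv Kw; apply: le_trans (lerD Kv Kw).
  by rewrite -mulrDr ler_wpM2l ?ler_normD// ltW.
have si0 : 0 < sigma^-1 by rewrite invr_gt0.
have Kb v : K v -> `|v.1| <= sigma^-1 * v.2.
  by rewrite /K /= => Kv; rewrite mulrC ler_pdivlMr// mulrC.
have E0 : E (x0, - (f0 + g x0)) by rewrite /E /= fx0 lee_fin; lra.
have Eb x : E x -> K (x - (x0, - (f0 + g x0))) -> x.2 <= - m.
  rewrite /E /= => Ex _.
  have := le_trans (fm _) (leeD2r (g x.1)%:E Ex).
  by rewrite -EFinD lee_fin; lra.
have [[x al] [Ex Kx xmax]] :=
  bishop_phelps _ _ _ _ _ _ _ Ecl Kcl K0 KD si0 Kb E0 Eb.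
have [fx fxE] : exists fx, f x = fx%:E.
  by move: Ex (fN x); rewrite /E /=; case: (f x) => // r _ _; exists r.
have hx : fx + g x <= - al.
  by move: Ex; rewrite /E /= fxE lee_fin; lra.
exists x, fx; split=> //.
  have : 0 <= al + (f0 + g x0).
    move: Kx; rewrite /K /= opprK; apply: le_trans.
    by rewrite mulr_ge0// ltW.
  lra.
move=> y; rewrite leNgt; apply/negP => hy.
have [fy fyE] : exists fy, f y = fy%:E.
  by move: hy (fN y); case: (f y) => // r _ _; exists r.
move: hy; rewrite fyE -EFinD lte_fin => hy.
have n0 : 0 <= sigma * `|y - x| by rewrite mulr_ge0// ltW.
have : (y, - (fy + g y)) = (x, al).
  apply: xmax; first by rewrite /E /= fyE lee_fin; lra.
  by rewrite /K /=; lra.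
by move=> /(congr1 snd)/= h; move: h hx hy n0; clear; lra.
Qed.

(** * Subgradients of convex functions, dual norm and localization *)

Lemma lsc_EFin (R : realType) (V : normedModType R) (g : V -> R) :
  continuous g -> lsc (EFin \o g).
Proof.
move=> gc; split=> // x a /=; rewrite lte_fin => ag.
exists [set y | a < g y]; last by move=> y /=; rewrite lte_fin.
by apply: (gc x (fun z => a < z)); exact: lt_nbhsr.
Qed.

Lemma subdiff_convex_real (R : realType) (V : normedModType R) (d : subdiff V)
    (g : V -> R) (y : V) (q : dual V) :
    subdiff_axioms d -> continuous g ->
    (forall x x' t, 0 <= t <= 1 ->
      g (t *: x + (1 - t) *: x') <= t * g x + (1 - t) * g x') ->
    d (EFin \o g) y q ->
  forall v, g y + q (v - y) <= g v.
Proof.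
move=> dax gc gconv dq v.
have ec D : econvex D (EFin \o g).
  by move=> x x' t _ _ t01 /=; rewrite -!EFinM -EFinD lee_fin gconv.
have h : exists2 e : R, 0 < e &
   [/\ forall z, ball y e z -> (EFin \o g) z \is a fin_num,
       econvex (ball y e) (EFin \o g) &
       forall z, ball y e z -> {for z, continuous (EFin \o g)}].
  exists 1 => //; split=> // z _.
  by apply: cvg_EFin; [exact: nearW|exact: gc].
have [_ /(_ (ec setT)) E] := subdiff_convex dax (lsc_EFin _ _ _ gc) h.
by move: dq; rewrite E => /(_ v) /=; rewrite -EFinD lee_fin.
Qed.

Lemma dual_norm_lt (R : realType) (V : normedModType R) (p q : dual V)
    (e : R) (v : V) :
  (dual_norm (p \+ q)%R < e%:E)%E -> `|p v + q v| <= e * `|v|.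
Proof.
move=> pqe; have [->|v0] := eqVneq v 0.
  by rewrite !linear0 addr0 !normr0 mulr0.
have nv : 0 < `|v| by rewrite normr_gt0.
have : (`|p (`|v|^-1 *: v) + q (`|v|^-1 *: v)|%:E < e%:E)%E.
  apply: le_lt_trans pqe; apply: ereal_sup_ubound.
  exists (`|v|^-1 *: v) => //; rewrite closed_ballE// /closed_ball_ /=.
  by rewrite sub0r normrN normrZ normfV normr_id mulVf ?gt_eqF.
rewrite !linearZ /= -mulrDr normrM normfV normr_id lte_fin mulrC => h.
by rewrite -ler_pdivrMr// ltW.
Qed.

(** The ball is closed, so the value is raised to [+oo] only on an open set. This localizes [f] to
    where it is bounded below. *)
Lemma lsc_restrict_ball (R : realType) (V : normedModType R) (f : V -> \bar R)
    (b : V) (eta : R) :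
  lsc f -> lsc (fun y => if `|y - b| <= eta then f y else +oo%E).
Proof.
move=> [fN fl]; split=> [x|x al]; first by case: ifP.
case: ifPn => [_ /fl[U Ux Uf]|xb _].
  by exists U => // y Uy; case: ifP => _; [exact: Uf|rewrite ltry].
exists [set y | eta < `|y - b|]; last first.
  by move=> y /=; rewrite ltNge => /negbTE ->; rewrite ltry.
have nc : {for x, continuous (fun y => `|y - b|)}.
  by apply: cvg_norm; apply: cvgB; [exact: cvg_id|exact: cvg_cst].
apply: (nc (fun z => eta < z)).
by apply: lt_nbhsr; rewrite ltNge.
Qed.

(** * A subgradient from strict growth on a drop *)

(** The reward rate [k1] lies [Dl] below the growth rate [k2], so a step of length [s] inside the
    drop loses at least [Dl * s]. Almost minimizing [f] plus the penalty thus forces short steps,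
    which keeps the minimizer near [b] and leaves room to test the penalty's subgradient along all
    of [B]. *)
Lemma subgradient_on_drop (R : realType) (X : completeNormedModType R)
    (d : subdiff X) (f : X -> \bar R) (B : set X) (b : X)
    (beta k2 gam eps : R) :
    subdiff_axioms d -> lsc f -> B !=set0 -> convex_set B -> bounded_set B ->
    0 < gam -> 0 < eps -> (f b <= beta%:E)%E ->
    (forall w s e, B w -> 0 < s < 1 -> `|e| <= gam * s ->
      ((beta + s * k2)%:E < f (b + s *: w + e)%R)%E) ->
  exists x (p : dual X), [/\ d f x p, `|x - b| < eps,
    (f x < (beta + eps)%:E)%E & forall w, B w -> k2 - eps <= p w].
Proof.
move=> dax flsc B0 cB bB gam0 eps0 fb fdrop.
have [fN fl] := flsc.
have [D' D'0 BD'] := bounded_set_norm _ _ _ bB.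
pose D := D' + 1.
have D1 : 1 <= D by rewrite lerDr ltW.
have D0 : 0 < D by rewrite (lt_le_trans _ D1).
have BD w : B w -> `|w| <= D by move=> /BD' h; rewrite (le_trans h)// lerDl.
have [f0 f0E] : exists f0, f b = f0%:E.
  by move: fb (fN b); case: (f b) => // r _ _; exists r.
have f0b : f0 <= beta by move: fb; rewrite f0E lee_fin.
have [eta1 eta10 feta] : exists2 eta1, 0 < eta1 &
    forall y, `|y - b| < eta1 -> ((f0 - 1)%:E < f y)%E.
  have [|V /nbhs_ballP[r /= r0 rV] Vf] := fl b (f0 - 1).
    by rewrite f0E lte_fin ltrBlDr ltrDl.
  exists r => // y yb; apply/Vf/rV.
  by rewrite -ball_normE /= distrC.
(* The unit of error: the value of [f] and the slope each lose fewer than 8 such units. *)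
pose Dl := Num.min eps 1 / 8.
have Dl0 : 0 < Dl by rewrite divr_gt0// lt_min eps0 ltr01.
have Dle : 8 * Dl <= eps by rewrite mulrC divfK// ge_min lexx.
have Dl1 : 8 * Dl <= 1 by rewrite mulrC divfK// ge_min lexx orbT.
pose k1 := k2 - Dl.
pose eta := Num.min eps eta1 / 2.
have eta0 : 0 < eta by rewrite divr_gt0// lt_min eps0 eta10.
have etae : 2 * eta <= eps by rewrite mulrC divfK// ge_min lexx.
have etae1 : 2 * eta <= eta1 by rewrite mulrC divfK// ge_min lexx orbT.
have n1 : 0 <= `|k1| by [].
(* The cap on near-optimal steps: it bounds the displacement by a quarter of [eta] and the reward by
   [Dl]. *)
have [s0 [s00 s04 s0eta s0eps]] : exists s0,
    [/\ 0 < s0, 4 * s0 <= 1, 4 * (s0 * (D + gam)) <= eta & s0 * `|k1| <= Dl].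
  have q0 : 0 < 4 * (D + gam) by rewrite mulr_gt0// addr_gt0.
  have q1 : 0 < `|k1| + 1 by rewrite ltr_wpDl.
  pose s0 := Num.min (1/4) (Num.min (eta / (4 * (D + gam))) (Dl / (`|k1| + 1))).
  have h0 : 0 < s0 by rewrite !lt_min; apply/and3P; split; exact: divr_gt0.
  have h1 : s0 <= 1/4 by rewrite ge_min lexx.
  have h2 : s0 <= eta / (4 * (D + gam)) by rewrite !ge_min lexx orbT.
  have h3 : s0 <= Dl / (`|k1| + 1) by rewrite !ge_min lexx !orbT.
  rewrite ler_pdivlMr// in h2; rewrite ler_pdivlMr// in h3.
  by exists s0; split=> //; lra.
have gs0 : 0 < gam * s0 by rewrite mulr_gt0.
(* An error above [gam * s0] then costs more than the reward, at most [|k1|], the drop of [f], below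
   1, and the tolerance [zt] together. *)
pose M := (2 + `|k1|) / (gam * s0).
have M0 : 0 < M by rewrite divr_gt0// ltr_wpDr.
have ME : M * (gam * s0) = 2 + `|k1| by rewrite divfK// gt_eqF.
(* Matched to the loss inside the drop: [Dl * s <= zt] means [s <= s0]. *)
pose zt := Dl * s0.
have zt0 : 0 < zt by rewrite mulr_gt0.
have zt4 : 4 * zt <= Dl.
  by rewrite /zt mulrCA ler_piMr// ltW.
pose sg := Dl / D.
have sg0 : 0 < sg by rewrite divr_gt0.
have sgD : sg * D = Dl by rewrite divfK// gt_eqF.
have sgDl : sg <= Dl by rewrite ler_pdivrMr// ler_peMr// ltW.
pose g y := descent B M k1 (y - b).
have gc : continuous g.
  move=> y; apply: (cvg_comp (fun y => y - b) (descent B M k1)).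
    by apply: cvgB; [exact: cvg_id|exact: cvg_cst].
  exact: descent_continuous.
have g_adh y e : 0 < e -> exists s w, [/\ 0 <= s <= 1/2, B w &
    M * `|y - b - s *: w| - s * k1 < g y + e].
  exact: descent_adherent.
have g_le y s w : 0 <= s <= 1/2 -> B w -> g y <= M * `|y - b - s *: w| - s * k1.
  exact: descent_le.
have g_lip y y' : g y <= g y' + M * `|y - y'|.
  have -> : y - y' = (y - b) - (y' - b) by rewrite opprB addrA subrK.
  exact: descent_lipschitz.
have gb : g b <= 0.
  have [w Bw] := B0; apply: le_trans (g_le b 0 w _ Bw) _.
    by rewrite lexx divr_ge0.
  by rewrite subrr scale0r subr0 normr0 mulr0 mul0r subr0.
have sk s : 0 <= s <= 1/2 -> s * k1 <= `|k1|.
  move=> /andP[s1 s2]; have : s * k1 <= s * `|k1| by rewrite ler_wpM2l// ler_norm.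
  have : s * `|k1| <= 1 * `|k1| by rewrite ler_wpM2r//; lra.
  lra.
have g_ge y : - `|k1| - 1 <= g y.
  have [s [w [s01 Bw h]]] := g_adh y 1 ltr01.
  have : 0 <= M * `|y - b - s *: w| by rewrite mulr_ge0// ltW.
  have := sk s s01; lra.
pose f1 y := if `|y - b| <= eta then f y else +oo%E.
have f1lsc : lsc f1 by exact: lsc_restrict_ball.
have f1b : f1 b = f0%:E by rewrite /f1 subrr normr0 ltW.
have f_ge y : `|y - b| <= eta -> ((f0 - 1)%:E < f y)%E.
  by move=> yb; apply: feta; lra.
have f1g_ge y : ((f0 - 1 - `|k1| - 1)%:E <= f1 y + (g y)%:E)%E.
  rewrite /f1; case: ifP => [/f_ge fy|_]; last by rewrite addye// leey.
  apply: (@le_trans _ _ ((f0 - 1)%:E + (g y)%:E)%E); last exact/leeD2r/ltW.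
  by rewrite -EFinD lee_fin; have := g_ge y; lra.
(* (P5) needs an attained minimum; the perturbation of slope [sg] provides one and changes the slope
   along [B] by at most [sg * D = Dl]. *)
have [xb [fx [f1x fxg xmin]]] :=
  ekeland _ _ f1 g b f0 _ sg (proj2 f1lsc) gc f1g_ge f1b sg0.
have [xbeta fxE] : `|xb - b| <= eta /\ f xb = fx%:E.
  by move: f1x; rewrite /f1; case: ifP.
have fxf0 : f0 - 1 < fx by have := f_ge _ xbeta; rewrite fxE lte_fin.
(* Near-minimizers of the infimum defining [g xb] are short: the drop condition
   excludes the small errors, the lower bound on [f] the large ones. *)
have short s w : 0 <= s <= 1/2 -> B w ->
    M * `|xb - b - s *: w| - s * k1 <= g xb + zt ->
  s <= s0 /\ `|xb - b - s *: w| <= gam * s0.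
  move=> s01 Bw h; have [s1 s2] := andP s01.
  set e := xb - b - s *: w in h *.
  have Me : 0 <= M * `|e| by rewrite mulr_ge0// ltW.
  have large : `|e| <= gam * s0.
    rewrite -(ler_pM2l M0) ME; have := sk s s01; lra.
  have [->|sn0] := eqVneq s 0; first by split => //; exact: ltW.
  have sp : 0 < s by rewrite lt_neqAle eq_sym sn0.
  split=> //; have [es|es] := leP `|e| (gam * s).
    have s1' : 0 < s < 1 by rewrite sp/=; lra.
    have := fdrop w s e Bw s1' es.
    have -> : b + s *: w + e = xb.
      by rewrite addrC addrA addrAC !subrK.
    rewrite fxE lte_fin => h'; rewrite -(ler_pM2l Dl0) -/zt.
    have kE : k2 = k1 + Dl by rewrite subrK.
    by move: h'; rewrite kE; lra.
  by rewrite -(ler_pM2l gam0) ltW// (lt_le_trans es).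
have [sx [wx [sx01 Bwx hx]]] := g_adh xb zt zt0.
have [sx0 ex0] := short sx wx sx01 Bwx (ltW hx).
have sx1 : 0 <= sx by case/andP: sx01.
have xbeta4 : 4 * `|xb - b| <= eta.
  rewrite -[xb - b](subrK (sx *: wx)).
  have : `|xb - b - sx *: wx + sx *: wx| <= gam * s0 + s0 * D.
    apply: le_trans (ler_normD _ _) _; rewrite normrZ ger0_norm//.
    by apply: lerD => //; apply: ler_pM => //; exact: BD.
  lra.
have fxbeta : fx <= beta + 2 * Dl.
  have := sk sx sx01.
  have : sx * k1 <= s0 * `|k1|.
    by apply: le_trans (ler_wpM2l sx1 (ler_norm _)) _; rewrite ler_wpM2r.
  have : 0 <= M * `|xb - b - sx *: wx| by rewrite mulr_ge0// ltW.
  lra.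
pose g1 y := g y + sg * `|y - xb|.
have nc : continuous (fun y => `|y - xb|).
  by move=> y; apply: cvg_norm; apply: cvgB; [exact: cvg_id|exact: cvg_cst].
have g1c : continuous g1.
  by move=> y; apply: cvgD; [exact: gc|apply: cvgMr; exact: nc].
have g1conv x y t : 0 <= t <= 1 ->
    g1 (t *: x + (1 - t) *: y) <= t * g1 x + (1 - t) * g1 y.
  move=> t01; have [t0 t1] := andP t01; have t1' : 0 <= 1 - t by rewrite subr_ge0.
  have affine v : t *: x + (1 - t) *: y - v = t *: (x - v) + (1 - t) *: (y - v).
    by rewrite !scalerBr addrACA -opprD -scalerDl addrCA subrr addr0 scale1r.
  have h1 : g (t *: x + (1 - t) *: y) <= t * g x + (1 - t) * g y.
    by rewrite /g affine; exact: descent_convex.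
  have h2 : `|t *: x + (1 - t) *: y - xb| <= t * `|x - xb| + (1 - t) * `|y - xb|.
    by rewrite affine; apply: le_trans (ler_normD _ _) _; rewrite !normrZ !ger0_norm.
  by have := ler_wpM2l (ltW sg0) h2; rewrite /g1; lra.
(* The three bounds serve, in order, to carry near-optimal pairs from [y] back to [xb], to keep [x]
   strictly inside the ball where [f1] is [f], and to make the error of [p + q] on [B] at most
   [Dl]. *)
pose z2 := Num.min (zt / (4 * M)) (Num.min (eta / 2) sg).
have M4 : 0 < 4 * M by rewrite mulr_gt0.
have z20 : 0 < z2 by rewrite !lt_min sg0 andbT; apply/andP; split; exact: divr_gt0.
have z2M : 4 * (M * z2) <= zt.
  by rewrite mulrA mulrC -ler_pdivlMr// ge_min lexx.
have z2eta : 2 * z2 <= eta.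
  by rewrite mulrC -ler_pdivlMr// !ge_min lexx orbT.
have z2sg : z2 <= sg by rewrite !ge_min lexx !orbT.
have [x [y [p [q [dp dq [xz yz] fz pq]]]]] : exists x y (p q : dual X),
    [/\ d f1 x p, d (EFin \o g1) y q, ball xb z2 x /\ ball xb z2 y,
      (`|f1 x - f1 xb| < z2%:E)%E & (dual_norm (p \+ q)%R < z2%:E)%E].
  apply: (subdiff_sum dax f1lsc) => //.
  - by move=> t u v _ _; apply: g1conv; rewrite ge0 le1.
  - by rewrite /dom /= f1x ltry.
  - by move=> z; rewrite f1x -EFinD /g1 subrr normr0 mulr0 addr0; exact: xmin.
have xz' : `|x - xb| < z2 by move: xz; rewrite -ball_normE /= distrC.
have yz' : `|y - xb| < z2 by move: yz; rewrite -ball_normE /= distrC.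
have xeta : `|x - b| < eta.
  have := ler_distD xb x b; lra.
exists x, p; split=> [|||w Bw].
- rewrite (subdiff_local dax flsc f1lsc)//.
  have nx : {for x, continuous (fun y => `|y - b|)}.
    by apply: cvg_norm; apply: cvgB; [exact: cvg_id|exact: cvg_cst].
  have : \forall y \near x, `|y - b| < eta.
    by apply: (nx (fun z => z < eta)); exact: lt_nbhsl.
  by apply: filterS => v vb; rewrite /f1 ltW.
- lra.
- have f1xE : f1 x = f x by rewrite /f1 ltW.
  move: fz; rewrite f1xE f1x; case: (f x) (fN x) => // v _.
  rewrite -EFinB abse_EFin !lte_fin ltr_norml => /andP[_]; lra.
have zt2 : 0 < zt / 2 by rewrite divr_gt0.
have [s [wy [s01 Bwy hy]]] := g_adh y _ zt2.
have [s1 s2] := andP s01.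
have s4 : 4 * s <= 1.
  suff : s <= s0 by lra.
  (* A pair optimal up to [zt / 2] at [y] is optimal up to [zt] at [xb], since moving the base point
     costs at most [2 * M * z2]. *)
  suff /(short s wy s01 Bwy)[] : M * `|xb - b - s *: wy| - s * k1 <= g xb + zt by [].
  have := g_lip y xb.
  have : M * `|xb - b - s *: wy| <= M * (`|xb - y| + `|y - b - s *: wy|).
    rewrite ler_wpM2l ?(ltW M0)//.
    have -> : xb - b - s *: wy = (xb - y) + (y - b - s *: wy).
      by rewrite !addrA subrK.
    exact: ler_normD.
  have : M * `|y - xb| <= M * z2 by rewrite ler_wpM2l ?ltW.
  rewrite [`|xb - y|]distrC; lra.
have hq : q w <= - k1 + sg * D + 4 * (zt / 2).
  apply: (descent_subgradient _ _ B M k1 sg (zt / 2) D s q b xb y wy w) => //.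
  - exact: ltW.
  - exact: ltW.
  - exact: subdiff_convex_real dax g1c g1conv dq.
  - exact: ltW.
  - exact: BD.
have := dual_norm_lt _ _ p q z2 w pq.
have : z2 * `|w| <= sg * D by apply: ler_pM => //; [exact: ltW|exact: BD].
rewrite sgD ler_norml => h1 /andP[h2 _].
by move: hq; rewrite sgD /k1; lra.
Qed.

(** * The multidirectional mean value inequality *)

Local Open Scope ereal_scope.

Theorem theorem1p3 (R : realType) (X : completeNormedModType R)
  (d : subdiff X) (d_feasible : feasible d)
  (A : set X) (A_nonempty : A !=set0) (A_convex : convex_set A)
  (A_bounded : bounded_set A) (A_closed : closed A) (a : X)
  (f : X -> \bar R) (f_lsc : lsc f) (fa : dom f a)
  (r : R)
  (hr : r%:E < ereal_sup [set ereal_inf (f @` enlarge A delta)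
                         | delta in [set delta : R | (0 < delta)%R]])
  (e : R) (e_gt0 : (0 < e)%R) :
  exists xi : X,
    [/\ enlarge (mdinterval a A) e xi,
        f xi < maxe (f a) r%:E + e%:E &
        exists2 p : dual X, d f xi p &
          r%:E - f a < ereal_inf [set (p x)%:E | x in A] - (p a)%:E].
Proof.
have [dax _] := d_feasible; have [fN fl] := f_lsc.
have [fr faE] : exists fr, f a = fr%:E.
  by move: fa (fN a); rewrite /dom /=; case: (f a) => // s _ _; exists s.
have ballE (z x : X) (h : R) : (0 < h)%R -> (`|x - z| <= h)%R ->
    exists2 u, closed_ball (0%R : X) 1%R u & (z + h *: u = x)%R.
  move=> h0 xz; exists (h^-1 *: (x - z))%R.
    rewrite closed_ballE// /closed_ball_ /= sub0r normrN normrZ gtr0_norm ?invr_gt0//.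
    by rewrite mulrC ler_pdivrMr// mul1r.
  by rewrite scalerA mulfV ?gt_eqF// scale1r addrC subrK.
have [_ [dl /= dl0 <-] rI] := ereal_sup_gt hr.
have [r3 rr3 r3I] : exists2 r3, (r < r3)%R & r3%:E <= ereal_inf (f @` enlarge A dl).
  move: rI; case: (ereal_inf _) => [v| |] //.
    by rewrite lte_fin => rv; exists v.
  by exists (r + 1)%R; rewrite ?ltrDl// leey.
(* The gap above [r] yields the final strict inequality; its bound by [e / 4] controls the value of
   [f]. *)
pose r2 := (r + Num.min ((r3 - r) / 2) (e / 4))%R.
have rr2 : (r < r2)%R by rewrite ltrDl lt_min !divr_gt0// subr_gt0.
have r2e : (r2 <= r + e / 4)%R by rewrite lerD2l ge_min lexx orbT.
have r23 : (r2 < r3)%R.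
  have : (r2 <= r + (r3 - r) / 2)%R by rewrite lerD2l ge_min lexx.
  lra.
pose rho := (Num.min (dl / 2) (e / 4))%R.
have rho0 : (0 < rho)%R by rewrite lt_min !divr_gt0.
have rhodl : (2 * rho <= dl)%R.
  have : (rho <= dl / 2)%R by rewrite ge_min lexx.
  lra.
have rhoe : (rho <= e / 4)%R by rewrite ge_min lexx orbT.
have fr3 x z : A z -> (`|x - z| <= 2 * rho)%R -> r3%:E <= f x.
  move=> Az xz; apply: le_trans r3I _; apply: ereal_inf_lbound.
  have [u u1 <-] := ballE z x dl dl0 (le_trans xz rhodl).
  by exists (z + dl *: u)%R => //; exists z => //; exists u.
have [T [b [z0 [c [/andP[T0 T1] Az0 bE cT [fb fdrop]]]]]] :=
  drop_maximal _ _ _ _ _ _ _ _ _ A_nonempty A_convex A_bounded fl faE rho0 r23 fr3.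
pose k2 := (T * (r2 - fr))%R.
have bc (z : X) : (z + c - b = z + (c - b))%R by rewrite addrA.
pose B := [set (z + c - b)%R | z in A].
have cB : convex_set B.
  move=> _ _ t /set_mem[x Ax <-] /set_mem[y Ay <-]; apply/mem_set.
  exists (t%:num *: x + (1 - t%:num) *: y)%R.
    by apply: convex_setP => //; rewrite ge0 le1.
  rewrite !bc -[RHS]/(t%:num *: (x + (c - b)) + (1 - t%:num) *: (y + (c - b)))%R.
  rewrite [X in (_ = X + _)%R]scalerDr [X in (_ = _ + X)%R]scalerDr [RHS]addrACA.
  by rewrite -(scalerDl (c - b)) [(t%:num + _)%R]addrC subrK scale1r.
have bB : bounded_set B.
  have [M M0 AM] := bounded_set_norm _ _ _ A_bounded.
  exists (M + `|c - b|)%R; split=> [|L /ltW ML _ [z Az <-] /=].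
    exact: num_real.
  rewrite bc; apply: le_trans ML; apply: le_trans (ler_normD _ _) _.
  by rewrite lerD2r AM.
have B0 : B !=set0 by have [z Az] := A_nonempty; exists (z + c - b)%R, z.
have gam0 : (0 < rho * T / 2)%R by rewrite divr_gt0// mulr_gt0.
(* The factor [T] anticipates the division by [T] below, after which half of the gap [r2 - r]
   remains. *)
pose eps := (Num.min (e / 4) (T * ((r2 - r) / 2)))%R.
have eps0 : (0 < eps)%R.
  by rewrite lt_min divr_gt0// mulr_gt0// divr_gt0// subr_gt0.
have epse : (eps <= e / 4)%R by rewrite ge_min lexx.
have epsT : (eps <= T * ((r2 - r) / 2))%R by rewrite ge_min lexx orbT.
have Bdrop w s u : B w -> (0 < s < 1)%R -> (`|u| <= rho * T / 2 * s)%R ->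
    ((r2 - k2) + s * k2)%:E < f (b + s *: w + u)%R.
  move=> [z Az <-] s01 us.
  have -> : ((r2 - k2) + s * k2 = r2 - (1 - s) * k2)%R by ring.
  exact: fdrop.
have [x [p [dp xb fx hp]]] := subgradient_on_drop _ _ _ _ _ _ _ _ _ _ dax f_lsc
  B0 cB bB gam0 eps0 fb Bdrop.
exists x; split.
(* [b] without the shift [c] lies on the segment from [a] to [z0]; the shift and the distance from
   [b] to [x] are each at most [e / 4]. *)
- pose y := (a + (1 - T) *: (z0 - a))%R.
  have yb : (b - y = c)%R.
    have -> : y = (T *: a + (1 - T) *: z0)%R.
      rewrite /y scalerBr (scalerBl 1%R T a) scale1r opprB addrCA.
      by rewrite [(a + _)%R]addrC subrK addrC.
    by rewrite bE addrC addKr.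
  have xy : (`|x - y| <= e)%R.
    have := ler_distD b x y; rewrite yb; lra.
  have [u u1 <-] := ballE y x e e_gt0 xy.
  exists y; last by exists u.
  exists (1 - T)%R; last by exists z0.
  by rewrite /= in_itv/=; lra.
- apply: (lt_le_trans fx).
  have -> : maxe (f a) r%:E = (Num.max fr r)%:E by rewrite faE EFin_max.
  rewrite -EFinD lee_fin.
  have m1 : (fr <= Num.max fr r)%R by rewrite le_max lexx.
  have m2 : (r <= Num.max fr r)%R by rewrite le_max lexx orbT.
  (* [r2 - k2] is the convex combination [T * fr + (1 - T) * r2]. *)
  have T1' : (0 <= 1 - T)%R by lra.
  have := ler_wpM2l (ltW T0) m1.
  have := ler_wpM2l T1' m2.
  have := ler_wpM2l T1' r2e.
  have : ((1 - T) * e <= 1 * e)%R by rewrite ler_wpM2r ?(ltW e_gt0)//; lra.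
  rewrite /k2; lra.
exists p => //.
have pb : (p b = T * p a + (1 - T) * p z0 + p c)%R.
  by rewrite bE !linearD !linearZ.
have hpA z : A z -> (k2 - eps + T * p a + (1 - T) * p z0 <= p z)%R.
  move=> Az; have : B (z + c - b)%R by exists z.
  by move=> /hp; rewrite linearB linearD /= pb; lra.
have hz0 := hpA _ Az0.
(* Taking [z = z0] in [hpA] and dividing by [T] gives [m <= p z0]; putting this back into [hpA]
   gives the same bound at every [z] of [A]. *)
pose m := (p a + (r2 - fr) - (r2 - r) / 2)%R.
have mz0 : (m <= p z0)%R.
  rewrite -(ler_pM2l T0); rewrite /m /k2 in hz0 *; lra.
have mA z : A z -> (m <= p z)%R.
  move=> /hpA; apply: le_trans.
  have T1' : (0 <= 1 - T)%R by lra.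
  by have := ler_wpM2l T1' mz0; rewrite /m /k2; lra.
apply: (@lt_le_trans _ _ (m%:E - (p a)%:E)).
  by rewrite faE -!EFinB lte_fin /m; lra.
apply: leeD2r; apply: le_ereal_inf_tmp => _ [z Az <-].
by rewrite lee_fin mA.
Qed.
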